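(* Let $(\overline y,\overline u)\in Y\times U$ be a local minimum of the optimal control problem $$\min_{(y,u)\in Y\times U}\ J(y,u)=\frac12\|y-z_d\|_{L^2(\Omega)^N}^2+\frac{\alpha}{2}\|u\|_{L^2(\Omega)^N}^2$$ subject to $$\mu\int_\Omega \varepsilon y:\varepsilon v\,dx+\nu\int_\Omega \mathsf{m}(\varepsilon y):\varepsilon v\,dx=\int_\Omega u\cdot v\,dx\quad\text{for all }v\in Y.$$ Then $$J_y(\overline y,\overline u)S'(\overline u;h)+J_u(\overline y,\overline u)h\ \ge\ 0\quad\text{for all }h\in U.$$
   Context: $N\in\{2,3\}$; $\Omega\subset\mathbb{R}^N$ is a bounded Lipschitz domain with boundary $\Gamma$; $\mu>0$, $\nu\ge 0$, $g>0$, $\alpha>0$ are constants; $z_d\in L^2(\Omega)^N$. $Y=\{y\in H^1(\Omega)^N:\nabla\cdot y=0\text{ in }\Omega,\ y=0\text{ on }\Gamma\}$ with the $H^1$-norm; $U=L^2(\Omega)^N$. $\varepsilon y=\frac12(\nabla y+\nabla y^T)$; $A:B$ is the Frobenius inner product and $|\cdot|$ the Frobenius norm on $\mathbb{R}^{N\times N}$. $\mathsf{m}(E)=\max(0,|E|-g)\frac{E}{|E|}$ for $E\ne0$, $\mathsf{m}(0)=0$. For each $u\in U$ the constraint equation has a unique solution $y=:S(u)\in Y$; $S:U\to Y$ is the solution operator. $S$ is directionally differentiable: $S'(u;h)=\lim_{t\downarrow0}\frac{S(u+th)-S(u)}{t}$ (limit in $Y$). $(\overline y,\overline u)$ is a local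 minimum if $\overline y=S(\overline u)$ and there is $r>0$ with $J(S(\overline u),\overline u)\le J(S(u),u)$ for all $u\in U$ with $\|u-\overline u\|_U\le r$. The partial derivatives of $J$ are $J_y(\overline y,\overline u)w=\int_\Omega(\overline y-z_d)\cdot w\,dx$ and $J_u(\overline y,\overline u)h=\alpha\int_\Omega\overline u\cdot h\,dx$. *)

(* Defs.v *)
From HB Require Import structures.
From mathcomp Require Import all_boot all_order all_algebra.
From mathcomp Require Import all_classical all_reals all_analysis.
From mathcomp Require Import measurable_realfun.
Set Implicit Arguments.
Unset Strict Implicit.
Unset Printing Implicit Defensive.
Import Order.TTheory GRing.Theory Num.Theory.
Import numFieldNormedType.Exports.
Local Open Scope classical_set_scope.
Local Open Scope ring_scope.

(* Matrices (hence row vectors, the points of R^n) with their Borel sets. *)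
Fact borel_mx_display : measure_display.
Proof. exact: default_measure_display. Qed.

Section borel_mx.
Variables (R : realType) (m n : nat).

Definition borel_mx : set (set 'M[R]_(m, n)) := <<s @open 'M[R]_(m, n) >>.

Let borel_mx0 : borel_mx set0.
Proof. exact: sigma_algebra0. Qed.

Let borel_mxC A : borel_mx A -> borel_mx (~` A).
Proof. exact: sigma_algebraC. Qed.

Let borel_mx_bigcup (F : (set 'M[R]_(m, n))^nat) :
  (forall i, borel_mx (F i)) -> borel_mx (\bigcup_i F i).
Proof. exact: sigma_algebra_bigcup. Qed.

HB.instance Definition _ := @isMeasurable.Build borel_mx_display
  'M[R]_(m, n) borel_mx borel_mx0 borel_mxC borel_mx_bigcup.
End borel_mx.

Section lebesgue_rV.
Variable R : realType.

Lemma open_measurable_mx m n (A : set 'M[R]_(m, n)) : open A -> measurable A.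
Proof. by move=> oA; exact: sub_gen_smallest. Qed.

Lemma measurable_coord_mx m n i j :
  measurable_fun setT (fun x : 'M[R]_(m, n) => x i j).
Proof.
apply: (measurability _ (RGenOpens.measurableE R)) => _ [_ [a [b ->]] <-].
rewrite setTI; apply: open_measurable_mx.
apply: open_comp; last exact: interval_open.
by move=> x _; exact: coord_continuous.
Qed.

Lemma measurable_fun_rV d (T : measurableType d) (D : set T) n
    (f : T -> 'rV[R]_n) :
  (forall j, measurable_fun D (fun t => f t ord0 j)) -> measurable_fun D f.
Proof.
move=> mf mD; move: (mD); apply: (measurability (@open 'rV[R]_n)) => // _ [A oA <-].
pose box (p : 'rV[rat]_n * nat) : set 'rV[R]_n :=
  [set x | forall j, ball (ratr (p.1 ord0 j) : R) p.2.+1%:R^-1 (x ord0 j)].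
pose F k := if @unpickle ('rV[rat]_n * nat)%type k is Some p
  then [set x | box p x /\ box p `<=` A] else set0.
have -> : A = \bigcup_k F k.
  apply/seteqP; split=> [x Ax|x [k _]]; last first.
    by rewrite /F; case: unpickle => // p [bx]; exact.
  have /nbhs_ballP[e /= e0 xeA] := open_nbhs_nbhs (conj oA Ax).
  have [k ke] : exists k : nat, k.+1%:R^-1 < e / 2.
    have /ltr_add_invr[k] : 0 < e / 2 by rewrite divr_gt0.
    by rewrite add0r => ?; exists k.
  have k0 : 0 < k.+1%:R^-1 :> R by rewrite invr_gt0.
  have qP j : exists q : rat, ball (ratr q : R) k.+1%:R^-1 (x ord0 j).
    have : x ord0 j - k.+1%:R^-1 < x ord0 j + k.+1%:R^-1.
      by rewrite ltrBlDr -addrA ltrDl addr_gt0.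
    move=> /rat_in_itvoo[q]; rewrite in_itv/= => /andP[q1 q2]; exists q.
    by rewrite /ball /= distrC ltr_distlC q1.
  have [q {}qP] := choice qP.
  exists (pickle ((\row_j q j, k) : 'rV[rat]_n * nat)%type) => //.
  rewrite /F pickleK; split=> [j /=|y /= yb]; first by rewrite mxE.
  apply: xeA; split=> // i j; rewrite ord1.
  have /= := yb j; rewrite mxE => qy.
  apply: (le_ball (_ : k.+1%:R^-1 + k.+1%:R^-1 <= e)).
    by rewrite [leRHS](splitr e) lerD// ltW.
  by apply: ball_triangle qy; apply: ball_sym; exact: qP.
rewrite preimage_bigcup setI_bigcupr; apply: bigcup_measurable => k _.
rewrite /F; case: unpickle => [p|]; last by rewrite preimage_set0 setI0.
have [bA|bA] := pselect (box p `<=` A); last first.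
  by rewrite [X in measurable X](_ : _ = set0)// -subset0 => x [_ []].
rewrite [X in measurable X](_ : _ = D `&` \bigcap_(j in [set: 'I_n])
    (D `&` (fun t => f t ord0 j) @^-1`
      ball (ratr (p.1 ord0 j) : R) p.2.+1%:R^-1)).
  apply: measurableI => //; apply: fin_bigcap_measurable => // j _.
  by apply: mf => //; exact: measurable_ball.
apply/seteqP; split=> [t [Dt [bt _]]|t [Dt bt]].
  by split=> // j _; split=> //; exact: bt.
by split=> //; split=> // j; have [] := bt j Logic.I.
Qed.

Definition rV_cons n (p : R * 'rV[R]_n) : 'rV[R]_n.+1 :=
  \row_i (if unlift ord0 i is Some j then p.2 ord0 j else p.1).

Lemma measurable_rV_cons n : measurable_fun setT (@rV_cons n).
Proof.
apply: measurable_fun_rV => i; rewrite /rV_cons.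
under eq_fun do rewrite mxE.
case: (unlift ord0 i) => [j|]; last exact: measurable_fst.
exact: (measurableT_comp (@measurable_coord_mx 1 n ord0 j) measurable_snd).
Qed.

Section step.
Variables (n : nat) (mu : {sigma_finite_measure set 'rV[R]_n -> \bar R}).

Definition lebesgue_step : set 'rV[R]_n.+1 -> \bar R :=
  pushforward (lebesgue_measure \x mu)%E (@rV_cons n).

Let mcons (A : set 'rV[R]_n.+1) :
  measurable A -> measurable (@rV_cons n @^-1` A).
Proof.
by move=> mA; rewrite -[X in measurable X]setTI; exact: measurable_rV_cons.
Qed.

Let lebesgue_step0 : lebesgue_step set0 = 0%E.
Proof. by rewrite /lebesgue_step /pushforward preimage_set0 measure0. Qed.

Let lebesgue_step_ge0 A : (0 <= lebesgue_step A)%E.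
Proof. by rewrite /lebesgue_step /pushforward measure_ge0. Qed.

Let lebesgue_step_sigma_additive : semi_sigma_additive lebesgue_step.
Proof.
move=> F mF tF mUF; rewrite /lebesgue_step /pushforward preimage_bigcup.
apply: measure_semi_sigma_additive.
- by move=> k; exact: mcons.
- apply/trivIsetP => /= i j _ _ ij; rewrite -preimage_setI.
  by move/trivIsetP : tF => /(_ _ _ _ _ ij) ->//; rewrite preimage_set0.
- by rewrite -preimage_bigcup; exact: mcons.
Qed.

HB.instance Definition _ := isMeasure.Build _ _ _ lebesgue_step
  lebesgue_step0 lebesgue_step_ge0 lebesgue_step_sigma_additive.

Let lebesgue_step_sigma_finite : sigma_finite setT lebesgue_step.
Proof.
have /sigma_finiteP[F [TF ndF Foo]] := sigma_finiteT (@lebesgue_measure R).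
have /sigma_finiteP[G [TG ndG Goo]] := sigma_finiteT mu.
pose split (x : 'rV[R]_n.+1) := (x ord0 ord0, \row_j x ord0 (lift ord0 j)).
have msplit : measurable_fun setT split.
  apply: measurable_fun_pair; first exact: measurable_coord_mx.
  apply: measurable_fun_rV => j /=; under eq_fun do rewrite mxE.
  exact: measurable_coord_mx.
have splitK p : split (rV_cons p) = p.
  case: p => a x; congr pair; first by rewrite mxE unlift_none.
  by apply/rowP => j; rewrite !mxE liftK.
exists (fun k => split @^-1` (F k `*` G k)).
  rewrite -preimage_bigcup (_ : \bigcup_k _ = setT) ?preimage_setT//.
  rewrite -setXTT TF TG predeqE => -[x y]; split; last first.
    move=> [/= [i _ Fix] [k _ Gky]]; exists (maxn i k) => //; split.
    - by move: x Fix; exact/subsetPset/ndF/leq_maxl.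
    - by move: y Gky; exact/subsetPset/ndG/leq_maxr.
  by move=> [i _ []/= ? ?]; split; exists i.
move=> k; have [mF Fkoo] := Foo k; have [mG Gkoo] := Goo k; split.
  rewrite -[X in measurable X]setTI; apply: msplit => //.
  exact: measurableX.
rewrite /lebesgue_step /pushforward -comp_preimage.
rewrite (_ : split \o _ = id) ?preimage_id//; last first.
  by apply/funext => p; exact: splitK.
by rewrite product_measure1E// lte_mul_pinfty// ge0_fin_numE.
Qed.

HB.instance Definition _ := Measure_isSigmaFinite.Build _ _ _ lebesgue_step
  lebesgue_step_sigma_finite.

End step.

(* n-dimensional Lebesgue measure, as the n-fold product of [lebesgue_measure]
   transported along R * R^n ~ R^(n+1). *)
Fixpoint lebesgue_rV (n : nat) : {sigma_finite_measure set 'rV[R]_n -> \bar R} :=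
  if n is k.+1 then lebesgue_step (lebesgue_rV k) else \d_(0 : 'rV[R]_0).

End lebesgue_rV.

Arguments lebesgue_rV R n : clear implicits.

Section tensors.
Variable R : realType.

Definition frob m n (A B : 'M[R]_(m, n)) : R := \sum_i \sum_j A i j * B i j.

Definition fnorm m n (A : 'M[R]_(m, n)) : R := Num.sqrt (frob A A).

Definition m_fun m n (g : R) (E : 'M[R]_(m, n)) : 'M[R]_(m, n) :=
  if E == 0 then 0 else (Num.max 0 (fnorm E - g) / fnorm E) *: E.

End tensors.

Section domains.
Variables (R : realType) (N : nat).

(* Near each boundary point, after the orthogonal change of coordinates Q, the
   set is the part of a ball lying above the graph of a Lipschitz function of
   the N - 1 coordinates other than the k-th. *)
Definition lipschitz_boundary (Omega : set 'rV[R]_N) : Prop :=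
  forall x, (closure Omega `\` Omega°) x ->
  exists (r : R) (Q : 'M[R]_N) (k : 'I_N) (gam : 'rV[R]_N.-1 -> R^o),
    [/\ 0 < r, Q *m Q^T = 1%:M, lipschitz gam &
      forall z : 'rV[R]_N, ball x r z ->
        (Omega z <-> gam (col' k (z *m Q)) < (z *m Q) ord0 k)].

Definition bounded_lipschitz_domain (Omega : set 'rV[R]_N) : Prop :=
  [/\ Omega !=set0, open Omega, connected Omega, bounded_set Omega &
      lipschitz_boundary Omega].

End domains.

Section sobolev.
Variables (R : realType) (N : nat) (Omega : set 'rV[R]_N).

(* Elements of L^2 and H^1 are represented by functions on the whole of R^N, of
   which only the values almost everywhere in Omega matter. *)
Definition L2 m n (f : 'rV[R]_N -> 'M[R]_(m, n)) : Prop :=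
  measurable_fun Omega f /\
  (\int[lebesgue_rV R N]_(x in Omega) (fnorm (f x) ^+ 2)%:E < +oo)%E.

Definition l2dot m n (f h : 'rV[R]_N -> 'M[R]_(m, n)) : R :=
  \int[lebesgue_rV R N]_(x in Omega) frob (f x) (h x).

Definition l2norm m n (f : 'rV[R]_N -> 'M[R]_(m, n)) : R :=
  Num.sqrt (l2dot f f).

Definition eq_ae_in m n (f h : 'rV[R]_N -> 'M[R]_(m, n)) : Prop :=
  {ae lebesgue_rV R N, forall x, Omega x -> f x = h x}.

Definition partial (j : 'I_N) (phi : 'rV[R]_N -> R^o) : 'rV[R]_N -> R^o :=
  'D_(delta_mx ord0 j) phi.

Definition smooth (phi : 'rV[R]_N -> R^o) : Prop :=
  forall s : seq 'I_N, let psi := foldr partial phi s in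
  continuous psi /\ forall x j, derivable psi x (delta_mx ord0 j).

Definition test_fun (phi : 'rV[R]_N -> R^o) : Prop :=
  let supp := closure [set x | phi x != 0] in
  [/\ smooth phi, compact supp & supp `<=` Omega].

(* The rows of G are the gradients of the components of y. *)
Definition is_weak_grad (y : 'rV[R]_N -> 'rV[R]_N)
    (G : 'rV[R]_N -> 'M[R]_N) : Prop :=
  forall phi, test_fun phi -> forall i j,
  \int[lebesgue_rV R N]_(x in Omega) (y x ord0 i * partial j phi x) =
  - \int[lebesgue_rV R N]_(x in Omega) (G x i j * phi x).

Definition H1 (y : 'rV[R]_N -> 'rV[R]_N) : Prop :=
  L2 y /\ exists G, L2 G /\ is_weak_grad y G.

(* Weak gradients are unique up to a null set; one of them is selected. *)
Definition wgrad (y : 'rV[R]_N -> 'rV[R]_N) : 'rV[R]_N -> 'M[R]_N :=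
  xget (fun=> 0) [set G | L2 G /\ is_weak_grad y G].

Definition h1norm (y : 'rV[R]_N -> 'rV[R]_N) : R :=
  Num.sqrt (l2norm y ^+ 2 + l2norm (wgrad y) ^+ 2).

(* y = 0 on the boundary: y is in H^1_0, the H^1-closure of C_c^oo. *)
Definition vanishes_on_boundary (y : 'rV[R]_N -> 'rV[R]_N) : Prop :=
  forall e : R, 0 < e -> exists phi : 'rV[R]_N -> 'rV[R]_N,
    (forall i, test_fun (fun x => phi x ord0 i)) /\ h1norm (y \- phi) < e.

Definition divergence_free (y : 'rV[R]_N -> 'rV[R]_N) : Prop :=
  {ae lebesgue_rV R N, forall x, Omega x -> \tr (wgrad y x) = 0}.

Definition Yspace (y : 'rV[R]_N -> 'rV[R]_N) : Prop :=
  [/\ H1 y, divergence_free y & vanishes_on_boundary y].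

Definition strain (y : 'rV[R]_N -> 'rV[R]_N) (x : 'rV[R]_N) : 'M[R]_N :=
  2^-1 *: (wgrad y x + (wgrad y x)^T).

End sobolev.

Section control_problem.
Variables (R : realType) (N : nat) (Omega : set 'rV[R]_N).
Variables (mu nu g alpha : R) (zd : 'rV[R]_N -> 'rV[R]_N).
Implicit Types y u h d : 'rV[R]_N -> 'rV[R]_N.

Definition state_equation u y : Prop :=
  forall v, Yspace Omega v ->
  mu * l2dot Omega (strain Omega y) (strain Omega v) +
  nu * l2dot Omega (fun x => m_fun g (strain Omega y x)) (strain Omega v) =
  l2dot Omega u v.

(* The solution in Y is unique up to a null set; one representative of it is
   selected. *)
Definition sol_op u : 'rV[R]_N -> 'rV[R]_N :=
  xget (fun=> 0) [set y | Yspace Omega y /\ state_equation u y].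

Definition is_dirder u h d : Prop :=
  Yspace Omega d /\
  h1norm Omega
    (fun x => t^-1 *: (sol_op (fun z => u z + t *: h z) x - sol_op u x) - d x)
    @[t --> 0^'+] --> (0 : R).

Definition directionally_differentiable : Prop :=
  forall u h, L2 Omega u -> L2 Omega h -> exists d, is_dirder u h d.

(* S'(u; h), again one representative of a class modulo null sets *)
Definition dirder u h : 'rV[R]_N -> 'rV[R]_N :=
  xget (fun=> 0) [set d | is_dirder u h d].

Definition cost y u : R :=
  2^-1 * l2norm Omega (y \- zd) ^+ 2 + alpha / 2 * l2norm Omega u ^+ 2.

Definition cost_y y u (w : 'rV[R]_N -> 'rV[R]_N) : R := l2dot Omega (y \- zd) w.

Definition cost_u y u h : R := alpha * l2dot Omega u h.

Definition local_minimum y u : Prop :=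
  eq_ae_in Omega y (sol_op u) /\
  exists r : R, 0 < r /\
    forall u', L2 Omega u' -> l2norm Omega (u' \- u) <= r ->
      cost (sol_op u) u <= cost (sol_op u') u'.

End control_problem.

(* Main.v *)
Require Import Defs.
From HB Require Import structures.
From mathcomp Require Import all_boot all_order all_algebra.
From mathcomp Require Import all_classical all_reals all_analysis.
From mathcomp Require Import measurable_realfun ring lra.
Set Implicit Arguments.
Unset Strict Implicit.
Unset Printing Implicit Defensive.
Import Order.TTheory GRing.Theory Num.Theory.
Import numFieldNormedType.Exports.
Local Open Scope classical_set_scope.
Local Open Scope ring_scope.

(* Along the ray u + t h the reduced cost is minimal at t = 0. With
   q_t = (S(u + t h) - S(u)) / t, the cost increment divided by t is
     <S(u) - z_d, q_t> + alpha <u, h> + (t / 2) (|q_t|^2 + alpha |h|^2) >= 0,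
   and q_t -> S'(u; h) in L^2, since the H^1-norm dominates the L^2-norm; only
   Cauchy-Schwarz and this convergence are needed to let t -> 0+. *)

(** * Algebra of the Frobenius inner product *)

Section frob_theory.
Context {R : realType} {m n : nat}.
Implicit Types A B C : 'M[R]_(m, n).

Lemma frobC A B : frob A B = frob B A.
Proof. by apply: eq_bigr => i _; apply: eq_bigr => j _; rewrite mulrC. Qed.

(** One shape [a *: A + B] serves throughout: scalings, sums and differences are its cases [B = 0],
    [a = 1] and [a = -1]. *)
Lemma frobDZl a A B C : frob (a *: A + B) C = a * frob A C + frob B C.
Proof.
rewrite /frob mulr_sumr -big_split; apply: eq_bigr => i _ /=.
rewrite mulr_sumr -big_split; apply: eq_bigr => j _ /=.
by rewrite !mxE mulrDl mulrA.
Qed.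

Lemma frob0l A : frob 0 A = 0.
Proof. by do 2![apply: big1 => ? _]; rewrite mxE mul0r. Qed.

Lemma frobZl a A B : frob (a *: A) B = a * frob A B.
Proof. by rewrite -[a *: A]addr0 frobDZl frob0l addr0. Qed.

Lemma frob_ge0 A : 0 <= frob A A.
Proof. by do 2![apply: sumr_ge0 => ? _]; rewrite -expr2 sqr_ge0. Qed.

Lemma fnorm_sqr A : fnorm A ^+ 2 = frob A A.
Proof. by rewrite sqr_sqrtr// frob_ge0. Qed.

Lemma frob_sqrDZ a A B :
  frob (a *: A + B) (a *: A + B) =
  a ^+ 2 * frob A A + 2 * a * frob A B + frob B B.
Proof. by rewrite frobDZl ![frob _ (_ + _)]frobC !frobDZl (frobC B A); ring. Qed.

(** Follows from the nonnegative squares of [A + B] and [B - A]. It supplies the pointwise majorant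
    that makes [frob (f x) (h x)] integrable for [f], [h] in L^2. *)
Lemma normr_frob_le A B : `|frob A B| <= frob A A + frob B B.
Proof.
have := frob_ge0 (1 *: A + B); have := frob_ge0 (-1 *: A + B).
rewrite !frob_sqrDZ; have := frob_ge0 A; have := frob_ge0 B.
by rewrite ler_norml => *; apply/andP; split; lra.
Qed.

End frob_theory.

(** * The L^2 inner product on [Omega] *)

Section L2_theory.
Context {R : realType} {N : nat} {Omega : set 'rV[R]_N}.
Hypothesis mOmega : measurable Omega.
Implicit Types f h k : 'rV[R]_N -> 'rV[R]_N.

Let measurable_coord f i j : measurable_fun Omega f ->
  measurable_fun Omega (fun x => f x i j).
Proof. by move=> mf; exact: (measurableT_comp (measurable_coord_mx i j) mf). Qed.

Let measurable_frob f h : measurable_fun Omega f -> measurable_fun Omega h ->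
  measurable_fun Omega (fun x => frob (f x) (h x)).
Proof.
move=> mf mh; do 2![apply: measurable_sum => ?].
by apply: measurable_funM; exact: measurable_coord.
Qed.

Let integrable_frob_diag f : L2 Omega f ->
  (lebesgue_rV R N).-integrable Omega (fun x => (frob (f x) (f x))%:E).
Proof.
move=> [mf foo]; apply/integrableP; split.
  by apply/measurable_EFinP; exact: measurable_frob.
under eq_integral do rewrite gee0_abs ?lee_fin ?frob_ge0// -fnorm_sqr.
exact: foo.
Qed.

Lemma integrable_frob f h : L2 Omega f -> L2 Omega h ->
  (lebesgue_rV R N).-integrable Omega (fun x => (frob (f x) (h x))%:E).
Proof.
move=> Lf Lh.
apply: (le_integrable mOmega _ _
  (integrableD mOmega (integrable_frob_diag Lf) (integrable_frob_diag Lh))).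
  by apply/measurable_EFinP; apply: measurable_frob; [case: Lf|case: Lh].
move=> x _ /=; rewrite lee_fin.
by rewrite (le_trans (normr_frob_le _ _))// ler_norm.
Qed.

Lemma L2_0 : L2 Omega (fun=> 0 : 'rV[R]_N).
Proof.
split; first exact: measurable_cst.
by rewrite integral0_eq ?ltry// => x _; rewrite fnorm_sqr frob0l.
Qed.

Lemma L2_DZ a f h : L2 Omega f -> L2 Omega h ->
  L2 Omega (fun x => a *: f x + h x).
Proof.
move=> Lf Lh; split.
  apply: measurable_fun_rV => j; under eq_fun do rewrite !mxE.
  apply: measurable_funD; last by apply: measurable_coord; case: Lh.
  apply: measurable_funM; first exact: measurable_cst.
  by apply: measurable_coord; case: Lf.
under eq_integral do rewrite fnorm_sqr frob_sqrDZ.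
apply: integrable_lty => //.
rewrite (_ : (fun x => _) = fun x => (((a ^+ 2)%:E * (frob (f x) (f x))%:E +
  (2 * a)%:E * (frob (f x) (h x))%:E) + (frob (h x) (h x))%:E)%E)//.
do 2?apply: integrableD => //; try apply: integrableZl => //;
  exact: integrable_frob.
Qed.

Lemma L2_Z a f : L2 Omega f -> L2 Omega (fun x => a *: f x).
Proof.
move=> Lf; have := L2_DZ a Lf L2_0.
by congr (L2 Omega); apply/funext => x; rewrite addr0.
Qed.

Lemma L2_B f h : L2 Omega f -> L2 Omega h -> L2 Omega (f \- h).
Proof.
move=> Lf Lh; have := L2_DZ (-1) Lh Lf.
by congr (L2 Omega); apply/funext => x; rewrite scaleN1r addrC.
Qed.

Lemma l2dotC f h : l2dot Omega f h = l2dot Omega h f.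
Proof. by apply: eq_Rintegral => x _; rewrite frobC. Qed.

Lemma l2dotDZl a f h k : L2 Omega f -> L2 Omega h -> L2 Omega k ->
  l2dot Omega (fun x => a *: f x + h x) k =
  a * l2dot Omega f k + l2dot Omega h k.
Proof.
move=> Lf Lh Lk; rewrite /l2dot.
under eq_Rintegral do rewrite frobDZl.
rewrite RintegralD//; last exact: integrable_frob.
  rewrite RintegralZl//; exact: integrable_frob.
exact: (integrableZl mOmega a (integrable_frob Lf Lk)).
Qed.

Lemma l2dot_ge0 f : 0 <= l2dot Omega f f.
Proof. by apply: Rintegral_ge0 => x _; exact: frob_ge0. Qed.

Lemma l2norm_sqr f : l2norm Omega f ^+ 2 = l2dot Omega f f.
Proof. by rewrite sqr_sqrtr// l2dot_ge0. Qed.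

Lemma l2dot_sqrDZ a f h : L2 Omega f -> L2 Omega h ->
  l2dot Omega (fun x => a *: f x + h x) (fun x => a *: f x + h x) =
  a ^+ 2 * l2dot Omega f f + 2 * a * l2dot Omega f h + l2dot Omega h h.
Proof.
move=> Lf Lh; have Lfh := L2_DZ a Lf Lh.
rewrite l2dotDZl// (l2dotC f) (l2dotC h) !l2dotDZl// (l2dotC h f).
by ring.
Qed.

Lemma l2norm_Z a f : 0 <= a -> L2 Omega f ->
  l2norm Omega (fun x => a *: f x) = a * l2norm Omega f.
Proof.
move=> a0 Lf; rewrite /l2norm -[in RHS](ger0_norm a0) -sqrtr_sqr -sqrtrM ?sqr_ge0//.
congr Num.sqrt; rewrite /l2dot -RintegralZl//; last exact: integrable_frob.
apply: eq_Rintegral => x _.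
by rewrite frobZl frobC frobZl mulrA -expr2.
Qed.

(** Cauchy-Schwarz by the discriminant: the quadratic polynomial [a] -> |a f + h|^2 is nonnegative
    for every real [a]. *)
Lemma l2dot_le f h : L2 Omega f -> L2 Omega h ->
  l2dot Omega f h <= l2norm Omega f * l2norm Omega h.
Proof.
move=> Lf Lh; apply: le_trans (ler_norm _) _.
rewrite -(@ler_pXn2r _ 2)// ?nnegrE ?mulr_ge0 ?sqrtr_ge0//.
rewrite real_normK ?num_real// exprMn !l2norm_sqr.
have H a : 0 <= a ^+ 2 * l2dot Omega f f + 2 * a * l2dot Omega f h +
    l2dot Omega h h by rewrite -l2dot_sqrDZ// l2dot_ge0.
have [f0|f0] := eqVneq (l2dot Omega f f) 0.
  have [->|c0] := eqVneq (l2dot Omega f h) 0.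
    by rewrite expr0n mulr_ge0// l2dot_ge0.
  (* With |f| = 0 the polynomial is affine with nonzero slope; at this [a] it would equal -1. *)
  have := H (- (l2dot Omega h h + 1) / (2 * l2dot Omega f h)).
  rewrite f0 mulr0 add0r (_ : 2 * _ * _ = - (l2dot Omega h h + 1)); first by lra.
  by field.
have {}f0 : 0 < l2dot Omega f f by rewrite lt_neqAle eq_sym f0 l2dot_ge0.
(* The minimiser of the quadratic. *)
have := H (- l2dot Omega f h / l2dot Omega f f).
rewrite (_ : _ + _ + _ =
  (l2dot Omega f f * l2dot Omega h h - l2dot Omega f h ^+ 2) / l2dot Omega f f).
  by rewrite pmulr_lge0 ?invr_gt0// subr_ge0.
by field; rewrite gt_eqF.
Qed.

(** Allows [ybar] to be exchanged for the representative chosen by [sol_op], with which it agrees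
    only almost everywhere. *)
Lemma l2dot_ae f f' h : L2 Omega f -> L2 Omega f' -> L2 Omega h ->
  eq_ae_in Omega f f' -> l2dot Omega f h = l2dot Omega f' h.
Proof.
move=> Lf Lf' Lh ff'; congr fine; apply: (ae_eq_integral (fun x => (frob (f' x) (h x))%:E)) => //.
- by have /integrableP[] := integrable_frob Lf Lh.
- by have /integrableP[] := integrable_frob Lf' Lh.
- by apply: filterS ff' => x ff' /ff' ->.
Qed.

(** The gradient term under the root is a square, whatever [wgrad] selects. Convergence of the
    quotients in Y thus passes to L^2. *)
Lemma l2norm_le_h1norm f : l2norm Omega f <= h1norm Omega f.
Proof.
rewrite -[leLHS](@ger0_norm _ (l2norm _ _)) ?sqrtr_ge0// -sqrtr_sqr.
by rewrite ler_wsqrtr// lerDl sqr_ge0.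
Qed.

End L2_theory.

(** * Square integrability of states and the limit along the ray *)

Lemma Yspace_L2 (R : realType) N (Omega : set 'rV[R]_N) y :
  Yspace Omega y -> L2 Omega y.
Proof. by case=> -[]. Qed.

(* Holds even where [sol_op] takes its default value 0. *)
Lemma sol_op_L2 (R : realType) N (Omega : set 'rV[R]_N) (mu nu g : R) u :
  L2 Omega (sol_op Omega mu nu g u).
Proof.
by rewrite /sol_op; case: xgetP => [y _ [/Yspace_L2]|_]//; exact: L2_0.
Qed.

Theorem theorem3p2 (R : realType) (N : nat) (hN : N = 2%N \/ N = 3%N)
    (Omega : set 'rV[R]_N) (hOmega : bounded_lipschitz_domain Omega)
    (mu nu g alpha : R) (hmu : 0 < mu) (hnu : 0 <= nu) (hg : 0 < g)
    (halpha : 0 < alpha)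
    (zd : 'rV[R]_N -> 'rV[R]_N) (hzd : L2 Omega zd)
    (hS : directionally_differentiable Omega mu nu g)
    (ybar ubar : 'rV[R]_N -> 'rV[R]_N)
    (hybar : Yspace Omega ybar) (hubar : L2 Omega ubar)
    (hmin : local_minimum Omega mu nu g alpha zd ybar ubar) :
  forall h : 'rV[R]_N -> 'rV[R]_N, L2 Omega h ->
    cost_y Omega zd ybar ubar (dirder Omega mu nu g ubar h)
      + cost_u Omega alpha ybar ubar h >= 0.
Proof.
move=> h Lh.
have mOmega : measurable Omega by case: hOmega => _ /open_measurable_mx.
set d := dirder _ _ _ _ _ _.
have [Yd dcvg] : is_dirder Omega mu nu g ubar h d := xgetPex _ (hS _ _ hubar Lh).
have Ld := Yspace_L2 Yd.
case: hmin => ybarE [r [r0 minr]].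
pose S t := sol_op Omega mu nu g (fun z => ubar z + t *: h z).
pose S0 := sol_op Omega mu nu g ubar.
have LS0 : L2 Omega S0 by exact: sol_op_L2.
pose f := S0 \- zd.
have Lf : L2 Omega f := L2_B mOmega LS0 hzd.
rewrite /cost_y /cost_u.
have -> : l2dot Omega (ybar \- zd) d = l2dot Omega f d.
  apply: (l2dot_ae mOmega (L2_B mOmega (Yspace_L2 hybar) hzd) Lf Ld).
  by apply: filterS ybarE => x + /[dup] Ox => /[apply] /= ->.
set c := l2dot Omega f d + alpha * l2dot Omega ubar h.
(* e t = q_t - S'(u; h) *)
pose e t x := t^-1 *: (S t x - S0 x) - d x.
pose n t := h1norm Omega (e t).
have Le t : L2 Omega (e t).
  exact: (L2_B mOmega (L2_Z mOmega _ (L2_B mOmega (sol_op_L2 _ _ _ _ _) LS0)) Ld).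
(* An upper bound for the cost increment divided by [t]: Cauchy-Schwarz bounds the product of [e t]
   with [f], and |q_t|^2 <= 2 (|e t|^2 + |d|^2) bounds the quadratic term. *)
pose B t := c + l2norm Omega f * n t +
  t * (n t * n t + l2dot Omega d d + alpha / 2 * l2dot Omega h h).
have BE : B t @[t --> 0^'+] --> c + l2norm Omega f * 0 +
  0 * (0 * 0 + l2dot Omega d d + alpha / 2 * l2dot Omega h h).
  have tcvg : t @[t --> (0:R)^'+] --> (0 : R) by exact: cvg_at_right_filter.
  apply: cvgD; first exact: (cvgD (cvg_cst _) (cvgM (cvg_cst _) dcvg)).
  apply: (cvgM tcvg); apply: cvgD (cvg_cst _); apply: cvgD (cvg_cst _).
  exact: (cvgM dcvg dcvg).
(* With [c] written as the limit of [B], it suffices that [0 <= B t] for small [t > 0]. *)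
have -> : c = c + l2norm Omega f * 0 +
  0 * (0 * 0 + l2dot Omega d d + alpha / 2 * l2dot Omega h h) by ring.
apply: (ler_cvg_to (cvg_cst 0) BE).
(* The added 1 keeps the divisor in the bound on [t] positive even if |h| = 0. *)
have n0 : 0 < l2norm Omega h + 1 by rewrite ltr_wpDl// sqrtr_ge0.
near=> t.
have t0 : 0 < t by near: t; exact: nbhs_right_gt.
have thr : t * l2norm Omega h <= r.
  have : t < r / (l2norm Omega h + 1).
    by near: t; apply: nbhs_right_lt; rewrite divr_gt0.
  rewrite ltr_pdivlMr// mulrDr mulr1 => /ltW; apply: le_trans.
  by rewrite lerDl ltW.
have uE : (fun z => ubar z + t *: h z) = (fun z => t *: h z + ubar z).
  by apply/funext => z; rewrite addrC.
have Lth : L2 Omega (fun z => ubar z + t *: h z) by rewrite uE; exact: L2_DZ.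
have := minr (fun z => ubar z + t *: h z).
rewrite [X in _ -> l2norm Omega X <= _ -> _](_ : _ = fun z => t *: h z); last first.
  by apply/funext => z /=; rewrite addrAC subrr add0r.
rewrite (l2norm_Z mOmega (ltW t0) Lh) => /(_ Lth thr).
rewrite /cost -/(S t) -/S0 -/f uE.
(* Here q_t is [1 *: e t x + d x], so that the expansions for [a *: f + h] apply both to q_t and to
   [t *: q_t + f]. *)
have -> : S t \- zd = (fun x => t *: (1 *: e t x + d x) + f x).
  apply/funext => x /=; rewrite scale1r subrK scalerA divff ?gt_eqF// scale1r.
  by rewrite /f /= addrA subrK.
have Lq : L2 Omega (fun x => 1 *: e t x + d x) := L2_DZ mOmega 1 (Le t) Ld.
rewrite !l2norm_sqr (l2dot_sqrDZ mOmega t Lq Lf) (l2dot_sqrDZ mOmega t Lh hubar).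
rewrite (l2dot_sqrDZ mOmega 1 (Le t) Ld) (l2dotDZl mOmega 1 (Le t) Ld Lf).
(* |d - e t|^2 >= 0 bounds the cross term in |e t + d|^2. *)
have := @l2dot_ge0 _ _ Omega (fun x => -1 *: e t x + d x).
rewrite (l2dot_sqrDZ mOmega (-1) (Le t) Ld).
have := l2dot_le mOmega (Le t) Lf.
have fn : l2norm Omega f * l2norm Omega (e t) <= l2norm Omega f * n t.
  by rewrite ler_wpM2l ?sqrtr_ge0//; exact: l2norm_le_h1norm.
have en : l2dot Omega (e t) (e t) <= n t ^+ 2.
  by rewrite -l2norm_sqr ler_sqr ?nnegrE ?sqrtr_ge0//; exact: l2norm_le_h1norm.
rewrite /B /c (l2dotC f d) (l2dotC ubar h) => efle q0 costle.
set ee := l2dot _ (e t) (e t) in en q0 costle.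
set ed := l2dot _ (e t) d in q0 costle.
set dd := l2dot _ d d in q0 costle *.
set hh := l2dot _ h h in costle *.
set ef := l2dot _ (e t) f in efle costle.
(* The cost inequality with the cost at [t = 0] cancelled and a factor [t] pulled out, to be divided
   by [t > 0]. *)
have tK : 0 <= t * (t / 2 * (ee + 2 * ed + dd) + ef + l2dot Omega d f +
    alpha / 2 * t * hh + alpha * l2dot Omega h ubar) by lra.
(* Multiplied by [t] beforehand, so that the final [lra] only combines products linearly. *)
have tQ : t * (ee + 2 * ed + dd) <= t * (2 * (n t ^+ 2 + dd)).
  by rewrite ler_pM2l//; lra.
move: tK; rewrite pmulr_rge0// => tK; lra.
Unshelve. all: by end_near.
Qed.
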